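(* Let $G$ be a regular Lie group with Lie algebra $\mathfrak{g}$. For all $d_1,d_2,d_3\in D$ and $X_1,X_2,X_3,Y_1,Y_2,Y_3\in\mathfrak{g}$, writing $s=d_1+d_2+d_3$, $$\exp\left(sX_1+\tfrac12s^2X_2+\tfrac16s^3X_3\right)\cdot\exp\left(sY_1+\tfrac12s^2Y_2+\tfrac16s^3Y_3\right)$$ $$=\exp\left(s(X_1+Y_1)+\tfrac12s^2\left(X_2+Y_2+[X_1,Y_1]\right)+\tfrac16s^3\left\{(X_3+Y_3)+\tfrac32\left([X_1,Y_2]+[X_2,Y_1]\right)+\tfrac12[X_1-Y_1,[X_1,Y_1]]\right\}\right).$$
   Context: The setting is synthetic differential geometry (SDG; intuitionistic reasoning). $\mathbb{R}$ is the line, a commutative unital $\mathbb{Q}$-algebra satisfying the general Kock–Lawvere axiom for all Weil algebras. $D=\{d\in\mathbb{R}\mid d^2=0\}$. A space $M$ is microlinear if $M^{(-)}$ sends to a limit diagram every finite diagram of infinitesimal spaces (spectra of Weil algebras) with cocone that $\mathbb{R}^{(-)}$ sends to a limit diagram. A Lie group is a group $G$ that is microlinear as a space. Its Lie algebra is $\mathfrak{g}=\{X:D\to G\mid X(0)=1\}$, an $\mathbb{R}$-module with bracket characterized by $[X,Y](d_1d_2)=X(d_1)Y(d_2)X(-d_1)Y(-d_2)$ for $d_1,d_2\in D$. $G$ is regular if for every $\varsigma:\mathbb{R}\to\mathfrak{g}$ there is a unique $\gamma:\mathbb{R}\to G$ with $\gamma(0)=1$ and $\gamma(t+d)=\gamma(t)\cdot\varsigma(t)(d)$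 for all $t\in\mathbb{R}$, $d\in D$. For $X\in\mathfrak{g}$, $\exp X=\gamma(1)$, where $\gamma$ corresponds to the constant map $\varsigma=X$. *)

(* Defs.v *)
(** Synthetic differential geometry, internally: spaces are types, maps are
    functions, and equality is Leibniz equality.

    The logic is intuitionistic.  The Kock-Lawvere axiom is refuted by excluded
    middle (unless the line is trivial), so no classical axiom is used here, and
    the ring and group structures of MathComp, which carry decidable equality,
    are unsuitable.  The axioms used (function extensionality, proof
    irrelevance, definite description) hold in the internal logic of a topos. *)
From Stdlib Require Import List FinFun QArith Ring Ring_theory.
From Stdlib Require Import FunctionalExtensionality ProofIrrelevance Description.

Set Implicit Arguments.
Unset Strict Implicit.
Unset Printing Implicit Defensive.

Declare Scope sdg_scope.
Delimit Scope sdg_scope with sdg.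
Local Open Scope sdg_scope.

Record comm_ring := CommRing {
  rcar :> Type;
  rO : rcar;
  rI : rcar;
  radd : rcar -> rcar -> rcar;
  rmul : rcar -> rcar -> rcar;
  rsub : rcar -> rcar -> rcar;
  ropp : rcar -> rcar;
  rth : ring_theory rO rI radd rmul rsub ropp (@eq rcar) }.

Arguments rO {_}.
Arguments rI {_}.
Notation "0" := rO : sdg_scope.
Notation "1" := rI : sdg_scope.
Infix "+" := radd : sdg_scope.
Infix "*" := rmul : sdg_scope.
Notation "- x" := (ropp x) : sdg_scope.

Record ring_hom (A B : comm_ring) (f : A -> B) : Prop := RingHom {
  hom_1 : f 1 = 1;
  hom_D : forall x y, f (x + y) = f x + f y;
  hom_M : forall x y, f (x * y) = f x * f y }.

Record algebra (R : comm_ring) := Algebra {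
  alg_ring :> comm_ring;
  scalar : R -> alg_ring;
  scalar_hom : ring_hom scalar }.

Arguments scalar {R} _ _.

Definition alg_hom (R : comm_ring) (A B : algebra R) (f : A -> B) : Prop :=
  ring_hom f /\ forall r, f (scalar A r) = scalar B r.

Lemma id_hom (R : comm_ring) : @ring_hom R R (fun x => x).
Proof. now split. Qed.

Definition self_algebra (R : comm_ring) : algebra R := Algebra (id_hom R).

Fixpoint lincomb (R : comm_ring) (A : algebra R) (c : list R) (b : list A) : A :=
  match c, b with
  | r :: c', w :: b' => scalar A r * w + lincomb c' b'
  | _, _ => 0
  end.

(** A Weil algebra is an algebra of the form [R + I] where the ideal [I], the
    kernel of the augmentation, is nilpotent and free of finite rank. *)
Record weil (R : comm_ring) := Weil {
  weil_alg :> algebra R;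
  aug : weil_alg -> R;
  aug_hom : alg_hom (A := weil_alg) (B := self_algebra R) aug;
  aug_free : exists b : list weil_alg,
    Forall (fun w => aug w = 0) b /\
    forall w, aug w = 0 ->
      exists! c : list R, length c = length b /\ lincomb c b = w;
  aug_nilpotent : exists k : nat, forall l : list weil_alg,
    length l = k -> Forall (fun w => aug w = 0) l -> fold_right (@rmul _) 1 l = 0 }.

Definition Spec (R : comm_ring) (W : weil R) : Type :=
  {p : W -> R | alg_hom (A := W) (B := self_algebra R) p}.

Definition ev (R : comm_ring) (W : weil R) (p : Spec W) : W -> R := proj1_sig p.

(** The canonical map [W -> R^(Spec W)] is bijective for every [W]. *)
Definition kock_lawvere (R : comm_ring) : Prop :=
  forall (W : weil R) (f : Spec W -> R),
    exists! w : W, forall p : Spec W, f p = ev p w.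

(** A ring morphism from [Q] makes the ring a Q-algebra; [Q] carries the setoid
    equality decided by [Qeq_bool]. *)
Record line := Line {
  line_ring :> comm_ring;
  of_Q : Q -> line_ring;
  of_Q_morph : ring_morph (R := line_ring) 0 1 (@radd _) (@rmul _) (@rsub _) (@ropp _)
                 eq 0%Q 1%Q Qplus Qmult Qminus Qopp Qeq_bool of_Q;
  line_KL : kock_lawvere line_ring }.

Arguments of_Q {_} _.

(** The shape is a finite graph rather than a finite category, and the arrows are
    arbitrary maps. *)
Record cocone_diagram (R : comm_ring) := CoconeDiagram {
  vertex : Set;
  edge : Set;
  vertex_fin : Finite' vertex;
  edge_fin : Finite' edge;
  source : edge -> vertex;
  target : edge -> vertex;
  node : vertex -> weil R;
  arrow : forall e, Spec (node (source e)) -> Spec (node (target e));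
  apex : weil R;
  leg : forall v, Spec (node v) -> Spec apex;
  leg_arrow : forall e p, leg (arrow (e := e) p) = leg p }.

Arguments node {R} _ _.
Arguments arrow {R} _ _ _.
Arguments leg {R} _ _ _.

(** [M^(-)] sends the diagram with its cocone to a limit diagram. *)
Definition exp_is_limit (R : comm_ring) (C : cocone_diagram R) (M : Type) : Prop :=
  forall phi : forall v, Spec (node C v) -> M,
    (forall e p, phi (target e) (arrow C e p) = phi (source e) p) ->
    exists! psi : Spec (apex C) -> M, forall v p, psi (leg C v p) = phi v p.

Definition microlinear (R : comm_ring) (M : Type) : Prop :=
  forall C : cocone_diagram R, exp_is_limit C R -> exp_is_limit C M.

Record group := Group {
  gcar :> Type;
  gone : gcar;
  gmul : gcar -> gcar -> gcar;
  ginv : gcar -> gcar;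
  gmulA : forall x y z, gmul x (gmul y z) = gmul (gmul x y) z;
  gmul1g : forall x, gmul gone x = x;
  gmulVg : forall x, gmul (ginv x) x = gone }.

Arguments gone {_}.
Infix "\*" := gmul (at level 40, left associativity) : sdg_scope.

Record lie_group (R : line) := LieGroup {
  lie_car :> group;
  lie_microlinear : microlinear R lie_car }.

Arguments lie_microlinear {R} _ _ _.

Definition D (R : comm_ring) : Type := {d : R | d * d = 0}.

Definition Dval (R : comm_ring) (d : D R) : R := proj1_sig d.
Coercion Dval : D >-> rcar.

(** [D(2)], the space of pairs in [D] with product zero. *)
Definition D2 (R : comm_ring) : Type := {p : D R * D R | fst p * snd p = 0}.

Section Infinitesimals.
Variable R : comm_ring.
Add Ring ring_R : (rth R).

Lemma D0_proof : (0 : R) * 0 = 0. Proof. ring. Qed.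
Lemma Dscale_proof (a : R) (d : D R) : (a * d) * (a * d) = 0.
Proof.
destruct d as [d Hd]; cbn; transitivity (a * a * (d * d)); [ring | rewrite Hd; ring].
Qed.
Lemma Dopp_proof (d : D R) : (- d) * (- d) = 0.
Proof. destruct d as [d Hd]; cbn; transitivity (d * d); [ring | exact Hd]. Qed.

Definition D0 : D R := exist _ 0 D0_proof.
Definition Dscale (a : R) (d : D R) : D R := exist _ (a * d) (Dscale_proof a d).
Definition Dopp (d : D R) : D R := exist _ (- d) (Dopp_proof d).

Lemma D2l_proof (d : D R) : fst (d, D0) * snd (d, D0) = 0. Proof. cbn; ring. Qed.
Lemma D2r_proof (d : D R) : fst (D0, d) * snd (D0, d) = 0. Proof. cbn; ring. Qed.
Lemma D2diag_proof (d : D R) : fst (d, d) * snd (d, d) = 0.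
Proof. exact (proj2_sig d). Qed.

Lemma Dscale0 (a : R) : Dscale a D0 = D0.
Proof. apply subset_eq_compat; cbn; ring. Qed.

Definition D2l (d : D R) : D2 R := exist _ (d, D0) (D2l_proof d).
Definition D2r (d : D R) : D2 R := exist _ (D0, d) (D2r_proof d).
Definition D2diag (d : D R) : D2 R := exist _ (d, d) (D2diag_proof d).
End Infinitesimals.

Definition lie_algebra (R : line) (G : lie_group R) : Type :=
  {X : D R -> G | X (D0 R) = gone}.

Definition lie_fun (R : line) (G : lie_group R) (X : lie_algebra G) : D R -> G :=
  proj1_sig X.
Coercion lie_fun : lie_algebra >-> Funclass.

(** Addition of tangent vectors: [X + Y] is the diagonal of the unique map on
    [D(2)] restricting to [X] and [Y] on the axes. *)
Definition is_lie_add (R : line) (G : lie_group R) (X Y Z : lie_algebra G) : Prop :=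
  exists l : D2 R -> G,
    (forall d, l (D2l d) = X d) /\ (forall d, l (D2r d) = Y d) /\
    (forall d, Z d = l (D2diag d)).

Definition is_lie_bracket (R : line) (G : lie_group R) (X Y Z : lie_algebra G) : Prop :=
  forall d1 d2 : D R,
    Z (Dscale d1 d2) = X d1 \* Y d2 \* X (Dopp d1) \* Y (Dopp d2).

Lemma lie_scale_proof (R : line) (G : lie_group R) (a : R) (X : lie_algebra G) :
  X (Dscale a (D0 R)) = gone.
Proof. rewrite Dscale0; exact (proj2_sig X). Qed.

Definition lie_scale (R : line) (G : lie_group R) (a : R) (X : lie_algebra G) :
    lie_algebra G :=
  exist _ (fun d => X (Dscale a d)) (lie_scale_proof a X).

(** Existence of sums and brackets: both are instances of
    microlinearity.  The spaces [D], [D(2)] and [D x D] are the spectra of [R[x]/(x^2)], [R[x,y]/(x,y)^2] and [R[x,y]/(x^2,y^2)]; the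
    tuples below list the coefficients of 1, x, y, xy. *)
Section WeilAlgebras.
Variable R : comm_ring.
Add Ring ring_R' : (rth R).

Ltac pring := try solve [ring];
  try match goal with
  | |- (_, _) = (_, _) => apply f_equal2; pring
  | |- _ :: _ = _ :: _ => apply f_equal2; pring
  end.
Ltac crush :=
  intros; cbn in *; repeat match goal with x : prod _ _ |- _ => destruct x end;
  cbn in *; pring; try reflexivity.

Lemma ring2_th : ring_theory (R := R * R) (0, 0) (1, 0)
  (fun u v => (fst u + fst v, snd u + snd v))
  (fun u v => (fst u * fst v, fst u * snd v + snd u * fst v))
  (fun u v => (fst u + - fst v, snd u + - snd v))
  (fun u => (- fst u, - snd u)) eq.
Proof. split; crush. Qed.

Definition alg2 : algebra R.
Proof.
refine (@Algebra R (CommRing ring2_th) (fun r => (r, 0)) _).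
abstract (split; crush).
Defined.

Lemma ring3_th : ring_theory (R := R * R * R) (0, 0, 0) (1, 0, 0)
  (fun '(a, b, c) '(a', b', c') => (a + a', b + b', c + c'))
  (fun '(a, b, c) '(a', b', c') => (a * a', a * b' + b * a', a * c' + c * a'))
  (fun '(a, b, c) '(a', b', c') => (a + - a', b + - b', c + - c'))
  (fun '(a, b, c) => (- a, - b, - c)) eq.
Proof. split; crush. Qed.

Definition alg3 : algebra R.
Proof.
refine (@Algebra R (CommRing ring3_th) (fun r => (r, 0, 0)) _).
abstract (split; crush).
Defined.

Lemma ring4_th : ring_theory (R := R * R * R * R) (0, 0, 0, 0) (1, 0, 0, 0)
  (fun '(a, b, c, e) '(a', b', c', e') => (a + a', b + b', c + c', e + e'))
  (fun '(a, b, c, e) '(a', b', c', e') =>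
     (a * a', a * b' + b * a', a * c' + c * a', a * e' + b * c' + c * b' + e * a'))
  (fun '(a, b, c, e) '(a', b', c', e') => (a + - a', b + - b', c + - c', e + - e'))
  (fun '(a, b, c, e) => (- a, - b, - c, - e)) eq.
Proof. split; crush. Qed.

Definition alg4 : algebra R.
Proof.
refine (@Algebra R (CommRing ring4_th) (fun r => (r, 0, 0, 0)) _).
abstract (split; crush).
Defined.


Definition weil1 : weil R.
Proof.
refine (@Weil R (self_algebra R) (fun a => a) _ _ _).
- abstract (split; [apply id_hom | reflexivity]).
- abstract (exists nil; split; [constructor |]; intros w ->; exists nil; split;
    [easy | now intros [|] []]).
- abstract (exists 1%nat; intros [|w []] Hl Hf; try discriminate Hl;
    apply Forall_inv in Hf; cbn in *; rewrite Hf; ring).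
Defined.

Definition weil2 : weil R.
Proof.
refine (@Weil R alg2 (fun '(a, b) => a) _ _ _).
- abstract (split; [split |]; crush).
- abstract (exists ((0, 1) :: nil); split; [repeat constructor |];
    intros [a b]; cbn; intros ->; exists (b :: nil); split;
    [split; crush | intros [|b' []] [Hl H]; try discriminate Hl;
     injection H as _ H; rewrite <- H; crush]).
- abstract (exists 2%nat; intros [|[a b] [|[a' b'] []]] Hl Hf; try discriminate Hl;
    inversion_clear Hf as [|? ? Ha Hf']; apply Forall_inv in Hf';
    cbn in *; subst; crush).
Defined.

Definition weil3 : weil R.
Proof.
refine (@Weil R alg3 (fun '(a, b, c) => a) _ _ _).
- abstract (split; [split |]; crush).
- abstract (exists ((0, 1, 0) :: (0, 0, 1) :: nil); split; [repeat constructor |];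
    intros [[a b] c]; cbn; intros ->; exists (b :: c :: nil); split;
    [split; crush | intros [|b' [|c' []]] [Hl H]; try discriminate Hl;
     injection H as _ H1 H2; rewrite <- H1, <- H2; crush]).
- abstract (exists 2%nat; intros [|[[a b] c] [|[[a' b'] c'] []]] Hl Hf;
    try discriminate Hl;
    inversion_clear Hf as [|? ? Ha Hf']; apply Forall_inv in Hf';
    cbn in *; subst; crush).
Defined.

Definition weil4 : weil R.
Proof.
refine (@Weil R alg4 (fun '(a, b, c, e) => a) _ _ _).
- abstract (split; [split |]; crush).
- abstract (exists ((0, 1, 0, 0) :: (0, 0, 1, 0) :: (0, 0, 0, 1) :: nil);
    split; [repeat constructor |];
    intros [[[a b] c] e]; cbn; intros ->; exists (b :: c :: e :: nil); split;
    [split; crush | intros [|b' [|c' [|e' []]]] [Hl H]; try discriminate Hl;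
     injection H as _ H1 H2 H3; rewrite <- H1, <- H2, <- H3; crush]).
- abstract (exists 3%nat;
    intros [|[[[a b] c] e] [|[[[a' b'] c'] e'] [|[[[a'' b''] c''] e''] []]]] Hl Hf;
    try discriminate Hl;
    inversion_clear Hf as [|? ? Ha Hf']; inversion_clear Hf' as [|? ? Ha' Hf''];
    apply Forall_inv in Hf''; cbn in *; subst; crush).
Defined.

End WeilAlgebras.

Definition Spec_map (R : comm_ring) (W W' : weil R) (g : W' -> W)
    (Hg : alg_hom (A := W') (B := W) g) (p : Spec W) : Spec W'.
Proof.
exists (fun w => ev p (g w)).
abstract (destruct p as [p [[p1 pD pM] ps]], Hg as [[g1 gD gM] gs]; cbn;
  split; [split |]; intros; congruence).
Defined.

Lemma Spec_eq (R : comm_ring) (W : weil R) (p q : Spec W) :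
  (forall w, ev p w = ev q w) -> p = q.
Proof.
intros H; destruct p as [p Hp], q as [q Hq]; apply subset_eq_compat.
now apply functional_extensionality.
Qed.

(** By Kock-Lawvere, a diagram induced by a limit diagram of Weil algebras is
    sent to a limit by [R^(-)]. *)
Lemma exp_is_limit_line (R : line) (C : cocone_diagram R)
    (g : forall e, node C (target e) -> node C (source e))
    (h : forall v, apex C -> node C v) :
  (forall e p w, ev (arrow C e p) w = ev p (g e w)) ->
  (forall v p w, ev (leg C v p) w = ev p (h v w)) ->
  (forall ws : forall v, node C v, (forall e, g e (ws (target e)) = ws (source e)) ->
     exists! w, forall v, h v w = ws v) ->
  exp_is_limit C R.
Proof.
intros Hg Hh Hlim phi Hphi.
assert (inj : forall (W : weil R) (u w : W), (forall p : Spec W, ev p u = ev p w) -> u = w).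
{ intros W u w H; destruct (line_KL (fun p => ev p u)) as [x [_ Hx]].
  now rewrite <- (Hx u), <- (Hx w). }
pose (ws v := proj1_sig (constructive_definite_description _ (line_KL (phi v)))).
assert (Hws : forall v p, phi v p = ev p (ws v))
  by (intros v; exact (proj2_sig (constructive_definite_description _ (line_KL (phi v))))).
clearbody ws.
destruct (Hlim ws) as [w [Hw Uw]].
{ intros e; apply inj; intros p; now rewrite <- Hg, <- !Hws, Hphi. }
exists (fun p => ev p w); split.
- intros v p; now rewrite Hh, Hw, Hws.
- intros psi Hpsi; apply functional_extensionality; intros p.
  destruct (line_KL psi) as [u [Hu _]]; rewrite Hu; f_equal; apply Uw.
  intros v; apply inj; intros q; now rewrite <- Hh, <- Hu, Hpsi, Hws.
Qed.

Section Points.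
Variable R : comm_ring.
Add Ring ring_R'' : (rth R).

Ltac unD := repeat match goal with
  | d : D _ |- _ => destruct d
  | d : D2 _ |- _ => destruct d as [[[] []]] end;
  unfold Dval in *; cbn in *.
Ltac pring := try solve [ring];
  try match goal with |- (_, _) = (_, _) => apply f_equal2; pring end.
Ltac crush := intros; cbn in *;
  repeat match goal with x : prod _ _ |- _ => destruct x end; cbn in *; pring.

Lemma square_in_D (W : weil R) (p : Spec W) (w : W) :
  w * w = 0 -> ev p w * ev p w = 0.
Proof.
destruct p as [p [[p1 pD pM] ps]]; cbn; intros H; rewrite <- pM, H.
transitivity (p 0 + p 0 + - p 0); [ring |].
rewrite <- pD; replace (0 + 0 : W) with (0 : W); [ring |].
symmetry; exact (Radd_0_l (rth W) _).
Qed.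

Lemma ev0 (W : weil R) (p : Spec W) : ev p 0 = 0.
Proof.
destruct p as [p [[p1 pD pM] ps]]; cbn.
transitivity (p 0 + p 0 + - p 0); [ring |].
rewrite <- pD; replace (0 + 0 : W) with (0 : W); [ring |].
symmetry; exact (Radd_0_l (rth W) _).
Qed.

Definition pt2 (d : D R) : Spec (weil2 R).
Proof.
exists (fun '(a, b) => a + b * d).
abstract (split; [split |]; crush; destruct d as [d Hd]; cbn;
  match goal with |- ?x = (?a + ?b * _) * (?a' + ?b' * _) =>
    transitivity (x + b * b' * (d * d)); [rewrite Hd |]; ring end).
Defined.

Definition unpt2 (p : Spec (weil2 R)) : D R.
Proof. exists (ev p (0, 1)). abstract (apply square_in_D; crush). Defined.

Lemma pt2K d : unpt2 (pt2 d) = d.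
Proof. destruct d; apply subset_eq_compat; cbn; ring. Qed.

Lemma unpt2K p : pt2 (unpt2 p) = p.
Proof.
apply Spec_eq; intros [a b]; destruct p as [p [[p1 pD pM] ps]]; cbn.
rewrite <- (ps a), <- (ps b), <- pM, <- pD at 1; f_equal; crush.
Qed.

Definition pt3 (x : D2 R) : Spec (weil3 R).
Proof.
exists (fun '(a, b, c) => a + b * fst (proj1_sig x) + c * snd (proj1_sig x)).
abstract (split; [split |]; crush; unD;
  match goal with H : ?d * ?e = 0, Hd : ?d * ?d = 0, He : ?e * ?e = 0 |-
      ?x = (_ + ?b * _ + ?c * _) * (_ + ?b' * _ + ?c' * _) =>
    transitivity (x + b * b' * (d * d) + (b * c' + c * b') * (d * e) + c * c' * (e * e));
    [rewrite H, Hd, He |]; ring end).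
Defined.

Definition unpt3 (p : Spec (weil3 R)) : D2 R.
Proof.
unshelve eexists (exist _ (ev p (0, 1, 0)) _, exist _ (ev p (0, 0, 1)) _).
1, 2: abstract (apply square_in_D; crush).
abstract (cbn; transitivity (ev p 0); [| apply ev0]; destruct p as [p [[p1 pD pM] ps]]; cbn;
  rewrite <- pM; f_equal; crush).
Defined.

Lemma pt3K x : unpt3 (pt3 x) = x.
Proof.
unD; apply subset_eq_compat; f_equal; apply subset_eq_compat; cbn; ring.
Qed.

Lemma unpt3K p : pt3 (unpt3 p) = p.
Proof.
apply Spec_eq; intros [[a b] c]; destruct p as [p [[p1 pD pM] ps]]; cbn.
rewrite <- (ps a), <- (ps b), <- (ps c), <- !pM, <- !pD at 1; f_equal; crush.
Qed.

Definition pt4 (d e : D R) : Spec (weil4 R).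
Proof.
exists (fun '(a, b, c, k) => a + b * d + c * e + k * (d * e)).
abstract (split; [split |]; crush; unD;
  match goal with Hd : ?d * ?d = 0, He : ?e * ?e = 0 |-
      ?x = (?a + ?b * ?d + ?c * ?e + ?k * _) * (?a' + ?b' * _ + ?c' * _ + ?k' * _) =>
    transitivity (x
      + (b * b' + (b * k' + k * b') * e + k * k' * (e * e)) * (d * d)
      + (c * c' + (c * k' + k * c') * d) * (e * e));
    [rewrite Hd, He |]; ring end).
Defined.

Definition unpt4l (p : Spec (weil4 R)) : D R.
Proof. exists (ev p (0, 1, 0, 0)). abstract (apply square_in_D; crush). Defined.
Definition unpt4r (p : Spec (weil4 R)) : D R.
Proof. exists (ev p (0, 0, 1, 0)). abstract (apply square_in_D; crush). Defined.

Lemma pt4lK d e : unpt4l (pt4 d e) = d.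
Proof. unD; apply subset_eq_compat; cbn; ring. Qed.
Lemma pt4rK d e : unpt4r (pt4 d e) = e.
Proof. unD; apply subset_eq_compat; cbn; ring. Qed.

Lemma unpt4K p : pt4 (unpt4l p) (unpt4r p) = p.
Proof.
apply Spec_eq; intros [[[a b] c] k]; destruct p as [p [[p1 pD pM] ps]]; cbn.
rewrite <- (ps a), <- (ps b), <- (ps c), <- (ps k), <- !pM, <- !pD at 1; f_equal; crush.
Qed.

Ltac hom := split; [split |]; crush.

Lemma hom_21 : alg_hom (A := weil2 R) (B := weil1 R) (fun '(a, b) => a).
Proof. hom. Qed.
Lemma hom_31 : alg_hom (A := weil3 R) (B := weil1 R) (fun '(a, b, c) => a).
Proof. hom. Qed.
Lemma hom_32l : alg_hom (A := weil3 R) (B := weil2 R) (fun '(a, b, c) => (a, b)).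
Proof. hom. Qed.
Lemma hom_32r : alg_hom (A := weil3 R) (B := weil2 R) (fun '(a, b, c) => (a, c)).
Proof. hom. Qed.
Lemma hom_42l : alg_hom (A := weil4 R) (B := weil2 R) (fun '(a, b, c, k) => (a, b)).
Proof. hom. Qed.
Lemma hom_42r : alg_hom (A := weil4 R) (B := weil2 R) (fun '(a, b, c, k) => (a, c)).
Proof. hom. Qed.
Lemma hom_420 : alg_hom (A := weil4 R) (B := weil2 R) (fun '(a, b, c, k) => (a, 0)).
Proof. hom. Qed.
Lemma hom_24 : alg_hom (A := weil2 R) (B := weil4 R) (fun '(a, b) => (a, 0, 0, b)).
Proof. hom. Qed.
Lemma hom_22 : alg_hom (A := weil2 R) (B := weil2 R) (fun '(a, b) => (a, 0)).
Proof. hom. Qed.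

Lemma fin_bool : Finite' bool.
Proof.
exists (true :: false :: nil); split; [| intros []; cbn; tauto].
repeat constructor; cbn; intuition discriminate.
Qed.

Lemma fin_obool : Finite' (option bool).
Proof.
exists (None :: Some true :: Some false :: nil); split; [| intros [[]|]; cbn; tauto].
repeat constructor; cbn; intuition discriminate.
Qed.

(** The span [D <- 1 -> D] with apex [D(2)]. *)
Definition node_add (v : option bool) : weil R := if v then weil2 R else weil1 R.
Definition leg_add (v : option bool) : Spec (node_add v) -> Spec (weil3 R) :=
  match v with
  | None => Spec_map hom_31
  | Some true => Spec_map hom_32l
  | Some false => Spec_map hom_32r
  end.

Definition cone_add : cocone_diagram R.
Proof.
refine (@CoconeDiagram R (option bool) bool fin_obool fin_bool (fun _ => None) Some
  node_add (fun e => Spec_map hom_21) (weil3 R) leg_add _).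
abstract (intros [] p; apply Spec_eq; intros [[a b] c]; reflexivity).
Defined.

(** The three maps [D -> D x D] (both axes and the zero map), coequalised by the
    multiplication [D x D -> D]. *)
Definition node_bracket (v : bool) : weil R := if v then weil4 R else weil2 R.
Definition arrow_bracket (e : option bool) : Spec (weil2 R) -> Spec (weil4 R) :=
  match e with
  | None => Spec_map hom_420
  | Some true => Spec_map hom_42l
  | Some false => Spec_map hom_42r
  end.
Definition leg_bracket (v : bool) : Spec (node_bracket v) -> Spec (weil2 R) :=
  if v return Spec (node_bracket v) -> Spec (weil2 R)
  then Spec_map hom_24 else Spec_map hom_22.

Definition cone_bracket : cocone_diagram R.
Proof.
refine (@CoconeDiagram R bool (option bool) fin_bool fin_obool
  (fun _ => false) (fun _ => true)
  node_bracket arrow_bracket (weil2 R) leg_bracket _).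
abstract (intros [[]|] p; apply Spec_eq; intros [a b]; reflexivity).
Defined.

End Points.

Section Existence.
Variable R : line.
Add Ring ring_R3 : (rth R).

Lemma cone_add_limit : exp_is_limit (cone_add R) R.
Proof.
apply exp_is_limit_line with
  (g := fun e => (fun '(a, b) => a) : weil2 R -> weil1 R)
  (h := fun v => match v return weil3 R -> node_add R v with
          | None => fun '(a, b, c) => a
          | Some true => fun '(a, b, c) => (a, b)
          | Some false => fun '(a, b, c) => (a, c)
          end).
- reflexivity.
- intros [[]|]; reflexivity.
- cbn; intros ws Hws.
  pose proof (Hws true) as H1; pose proof (Hws false) as H2.
  destruct (ws (Some true)) as [a b] eqn:E1, (ws (Some false)) as [a' c] eqn:E2.
  cbn in H1, H2; subst a a'.
  exists (ws None, b, c); split.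
  + intros [[]|]; congruence.
  + intros [[a b'] c'] H.
    pose proof (H None) as K0; pose proof (H (Some true)) as K1;
    pose proof (H (Some false)) as K2; cbn in *; congruence.
Qed.

Lemma cone_bracket_limit : exp_is_limit (cone_bracket R) R.
Proof.
apply exp_is_limit_line with
  (g := fun e => match e return weil4 R -> weil2 R with
          | None => fun '(a, b, c, k) => (a, 0)
          | Some true => fun '(a, b, c, k) => (a, b)
          | Some false => fun '(a, b, c, k) => (a, c)
          end)
  (h := fun v => match v return weil2 R -> node_bracket R v with
          | true => fun '(a, b) => (a, 0, 0, b)
          | false => fun '(a, b) => (a, 0)
          end).
- intros [[]|]; reflexivity.
- intros []; reflexivity.
- cbn; intros ws Hws.
  pose proof (Hws None) as H0; pose proof (Hws (Some true)) as H1;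
  pose proof (Hws (Some false)) as H2; cbn in *.
  destruct (ws true) as [[[a b] c] k] eqn:E1, (ws false) as [a' b'] eqn:E2.
  exists (a, k); split.
  + intros []; congruence.
  + intros [x y] H; pose proof (H true) as K1; cbn in *; congruence.
Qed.

Variable G : lie_group R.

Lemma lie_ext (X Y : lie_algebra G) : (forall d, X d = Y d) -> X = Y.
Proof.
intros H; destruct X as [X HX], Y as [Y HY]; apply subset_eq_compat.
now apply functional_extensionality.
Qed.

Lemma lie_fun0 (X : lie_algebra G) (d : D R) : (d : R) = 0 -> X d = gone.
Proof.
intros Hd; rewrite <- (proj2_sig X); unfold lie_fun; f_equal.
destruct d; now apply subset_eq_compat.
Qed.

Lemma D2_exists (X Y : D R -> G) : X (D0 R) = Y (D0 R) ->
  exists! l : D2 R -> G, (forall d, l (D2l d) = X d) /\ (forall d, l (D2r d) = Y d).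
Proof.
intros H0.
assert (p0 : forall p : Spec (weil1 R), unpt2 (Spec_map (hom_21 R) p) = D0 R)
  by (intros p; apply subset_eq_compat, (ev0 p)).
pose (f (v : option bool) := match v return Spec (node_add R v) -> G with
  | None => fun _ => X (D0 R)
  | Some true => fun p => X (unpt2 p)
  | Some false => fun p => Y (unpt2 p)
  end).
destruct (lie_microlinear G _ cone_add_limit f) as [l [Hl Ul]].
{ intros [] p; cbn; now rewrite p0. }
exists (fun x => l (pt3 x)); split; [split; intros d |].
- rewrite <- (pt2K d) at 2; pose proof (Hl (Some true) (pt2 d)) as K; cbn in K; rewrite <- K; f_equal.
  apply Spec_eq; intros [[a b] c]; cbn; ring.
- rewrite <- (pt2K d) at 2; pose proof (Hl (Some false) (pt2 d)) as K; cbn in K; rewrite <- K; f_equal.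
  apply Spec_eq; intros [[a b] c]; cbn; ring.
- intros m [mX mY]; apply functional_extensionality; intros x.
  rewrite (Ul (fun p => m (unpt3 p))); [now rewrite pt3K |].
  intros [[]|] p; cbn; (rewrite <- mX || rewrite <- mY); f_equal;
    apply subset_eq_compat, f_equal2; apply subset_eq_compat;
    (reflexivity || apply (ev0 p)).
Qed.

Lemma lie_add_exists (X Y : lie_algebra G) : exists! Z, is_lie_add X Y Z.
Proof.
destruct (@D2_exists X Y) as [l [[HX HY] Ul]];
  [now rewrite !lie_fun0 |].
unshelve eexists (exist _ (fun d => l (D2diag d)) _).
{ cbn; rewrite <- (proj2_sig X); fold (lie_fun X); rewrite <- HX; f_equal.
  now apply subset_eq_compat. }
split.
- exists l; auto.
- intros Z [m [mX [mY mZ]]]; apply lie_ext; intros d; rewrite mZ; cbn.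
  now rewrite (Ul m).
Qed.

Lemma gmulgV (x : G) : x \* ginv x = gone.
Proof.
rewrite <- (gmul1g (x \* ginv x)), <- (gmulVg (ginv x)) at 1.
rewrite <- gmulA, (gmulA (ginv x) x), gmulVg, gmul1g; apply gmulVg.
Qed.

Lemma gmulg1 (x : G) : x \* gone = x.
Proof. now rewrite <- (gmulVg x), gmulA, gmulgV, gmul1g. Qed.

Lemma lie_fun_opp (X : lie_algebra G) (d : D R) : X d \* X (Dopp d) = gone.
Proof.
destruct (@D2_exists X X eq_refl) as [l [_ Ul]].
assert (sq : forall x : D2 R,
  (fst (proj1_sig x) + snd (proj1_sig x)) * (fst (proj1_sig x) + snd (proj1_sig x)) = 0).
{ intros [[[d1 H1] [d2 H2]] H]; cbn in *.
  transitivity (d1 * d1 + d2 * d2 + d1 * d2 + d1 * d2); [ring |].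
  rewrite H1, H2, H; ring. }
pose (m1 (x : D2 R) := X (fst (proj1_sig x)) \* X (snd (proj1_sig x))).
pose (m2 (x : D2 R) := X (exist _ _ (sq x) : D R)).
assert (E : m1 = m2).
{ transitivity l; [symmetry |]; apply Ul; split; intros [d' H']; unfold m1, m2; cbn.
  - rewrite (@lie_fun0 X (D0 R)), gmulg1; easy.
  - rewrite (@lie_fun0 X (D0 R)), gmul1g; easy.
  - f_equal; apply subset_eq_compat; cbn; ring.
  - f_equal; apply subset_eq_compat; cbn; ring. }
assert (Hd : fst (d, Dopp d) * snd (d, Dopp d) = 0).
{ destruct d as [d H]; cbn; transitivity (- (d * d)); [ring | rewrite H; ring]. }
change (m1 (exist _ (d, Dopp d) Hd) = gone); rewrite E; apply lie_fun0; cbn; ring.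
Qed.

Lemma lie_bracket_exists (X Y : lie_algebra G) : exists! Z, is_lie_bracket X Y Z.
Proof.
pose (f (v : bool) := match v return Spec (node_bracket R v) -> G with
  | true => fun p => X (unpt4l p) \* Y (unpt4r p)
                     \* X (Dopp (unpt4l p)) \* Y (Dopp (unpt4r p))
  | false => fun _ => gone
  end).
destruct (lie_microlinear G _ cone_bracket_limit f) as [l [Hl Ul]].
{ assert (opp0 : forall x : R, x = 0 -> - x = 0) by (intros x ->; ring).
  intros [[]|] p; cbn.
  - rewrite (@lie_fun0 Y (unpt4r _)), (@lie_fun0 Y (Dopp _));
      [| apply opp0, (ev0 p) | apply (ev0 p)].
    rewrite !gmulg1; apply lie_fun_opp.
  - rewrite (@lie_fun0 X (unpt4l _)), (@lie_fun0 X (Dopp _));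
      [| apply opp0, (ev0 p) | apply (ev0 p)].
    rewrite gmul1g, gmulg1; apply lie_fun_opp.
  - rewrite (@lie_fun0 X (unpt4l _)), (@lie_fun0 Y (unpt4r _)), (@lie_fun0 X (Dopp _)),
      (@lie_fun0 Y (Dopp _));
      [now rewrite !gmulg1 | apply opp0, (ev0 p) | apply opp0, (ev0 p)
      | apply (ev0 p) | apply (ev0 p)]. }
assert (mult : forall d1 d2, Spec_map (hom_24 R) (pt4 d1 d2) = pt2 (Dscale d1 d2)).
{ intros d1 d2; apply Spec_eq; intros [a b]; cbn; ring. }
unshelve eexists (exist _ (fun d => l (pt2 d)) _).
{ cbn; transitivity (l (Spec_map (hom_24 R) (pt4 (D0 R) (D0 R))));
    [now rewrite mult, Dscale0 |].
  transitivity (f true (pt4 (D0 R) (D0 R))); [apply (Hl true) |]; cbn.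
  rewrite pt4lK, pt4rK, !lie_fun0 by (cbn; ring); now rewrite !gmulg1. }
split.
- intros d1 d2; cbn; rewrite <- mult.
  transitivity (f true (pt4 d1 d2)); [apply (Hl true) |]; cbn.
  now rewrite pt4lK, pt4rK.
- intros Z HZ; apply lie_ext; intros d; cbn.
  rewrite (Ul (fun p => Z (unpt2 p))); [now rewrite pt2K |].
  intros [] p; cbn.
  + rewrite <- HZ; f_equal; apply subset_eq_compat; cbn.
    destruct p as [p [[p1 pD pM] ps]]; cbn; rewrite <- pM; f_equal; cbn.
    repeat apply f_equal2; ring.
  + apply lie_fun0, (ev0 p).
Qed.

End Existence.

Definition lie_add (R : line) (G : lie_group R) (X Y : lie_algebra G) : lie_algebra G :=
  proj1_sig (constructive_definite_description _ (lie_add_exists X Y)).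

Definition lie_bracket (R : line) (G : lie_group R) (X Y : lie_algebra G) :
    lie_algebra G :=
  proj1_sig (constructive_definite_description _ (lie_bracket_exists X Y)).

Definition lie_opp (R : line) (G : lie_group R) (X : lie_algebra G) : lie_algebra G :=
  lie_scale (ropp 1) X.

Infix "\+" := lie_add (at level 50, left associativity) : sdg_scope.
Notation "X \- Y" := (lie_add X (lie_opp Y))
  (at level 50, left associativity) : sdg_scope.
Infix "\*:" := lie_scale (at level 40, left associativity) : sdg_scope.
Notation "[[ X , Y ]]" := (lie_bracket X Y) (format "[[ X ,  Y ]]") : sdg_scope.

Definition is_integral (R : line) (G : lie_group R)
    (sigma : R -> lie_algebra G) (gamma : R -> G) : Prop :=
  gamma 0 = gone /\
  forall (t : R) (d : D R), gamma (t + d) = gamma t \* sigma t d.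

Definition regular (R : line) (G : lie_group R) : Prop :=
  forall sigma : R -> lie_algebra G, exists! gamma : R -> G, is_integral sigma gamma.

Definition integral (R : line) (G : lie_group R) (HG : regular G)
    (sigma : R -> lie_algebra G) : R -> G :=
  proj1_sig (constructive_definite_description _ (HG sigma)).

Definition lie_exp (R : line) (G : lie_group R) (HG : regular G) (X : lie_algebra G) : G :=
  integral HG (fun _ => X) 1.

(* Main.v *)
Require Import Defs.
From Stdlib Require Import QArith.
From Stdlib Require Import ProofIrrelevance Description.

(** Let [X(t)] be the cubic curve [t X1 + t^2/2 X2 + t^3/6 X3], let [Y(t)] and
    [Z(t)] be the corresponding curves for the two other exponents, and consider
    the claim [exp X(t) exp Y(t) = exp Z(t)].  It is trivial at [t = 0], and it
    propagates from [t] to [t + d] whenever [t^3 = 0] and [d] is in [D]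
    (lemma [bch_step]).  Three such steps, at [t = 0], [d1] and [d1 + d2], reach
    [s = d1 + d2 + d3].

    In a step, [X(t + d) = X + d V] with [X = X(t)] and [V = X'(t)], so one has
    to differentiate [exp].  If a curve [W] in the Lie algebra solves
    [W' = V - [X, W]], then [W(0)(-d) exp(uX) W(u)(d)] is, as a function of [u],
    an integral of the constant [X + dV], hence equals [exp(u(X + dV))] by
    uniqueness of integrals (lemma [lie_exp_twist]).  This uses only that the
    commutator of [X(e)] and [W(d)] is [[X, W](ed)].  When [ad X] is nilpotent
    the solution [W] is a polynomial in [u]; here [[X, V] = O(t^2)] because [X(t)]
    starts with [t X1] and [V] with [X1], so that [[X, [X, V]] = 0] and
    [exp(X + dV) = exp(X) (V - [X, V]/2)(d)].  The same lemma moves an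
    infinitesimal factor [W(d)] past [exp(Y + dU)].

    Both sides of the claim at [t + d] thereby become the common value at [t]
    times one tangent vector evaluated at [d], and what remains is an equality in
    the Lie algebra between two polynomials of degree 2 in [t].  It follows from
    bilinearity and antisymmetry of the bracket.  Microlinearity enters twice: a
    map on [D(2)] is determined by its restrictions to the axes, which makes the
    Lie algebra a module, and a tangent vector is determined by its values at
    the products [d e], which gives the laws of the bracket. *)

Local Open Scope sdg_scope.

Set Implicit Arguments.
Unset Strict Implicit.
Unset Printing Implicit Defensive.

Section LieGroup.
Variables (R : line) (G : lie_group R).
Add Ring ring_R : (rth R).
Implicit Types (X Y Z : lie_algebra G) (d e : D R).

(** * The module of tangent vectors *)

Lemma D_eq d e : (d : R) = e -> d = e.
Proof. destruct d, e; apply subset_eq_compat. Qed.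

(** Every computation with tangent vectors at infinitesimals of product zero rests
    on this consequence of microlinearity. *)
Lemma D2_map_eq (f g : D2 R -> G) :
  (forall d, f (D2l d) = g (D2l d)) -> (forall d, f (D2r d) = g (D2r d)) -> f = g.
Proof.
intros Hl Hr.
destruct (@D2_exists R G (fun d => g (D2l d)) (fun d => g (D2r d))) as (l & _ & Ul).
{ f_equal; apply subset_eq_compat; reflexivity. }
rewrite <- (Ul f), <- (Ul g); auto.
Qed.

Lemma sum_in_D d e : (d : R) * e = 0 -> ((d : R) + e) * (d + e) = 0.
Proof.
destruct d as [d Hd], e as [e He]; cbn; intros H.
transitivity (d * d + e * e + d * e + d * e); [ring | rewrite Hd, He, H; ring].
Qed.

Lemma lie_funD X d e (H : (d : R) * e = 0) :
  X (exist _ _ (sum_in_D H) : D R) = X d \* X e.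
Proof.
pose (f (x : D2 R) := X (exist _ _ (sum_in_D (proj2_sig x)) : D R)).
pose (g (x : D2 R) := X (fst (proj1_sig x)) \* X (snd (proj1_sig x))).
assert (E : f = g).
{ apply D2_map_eq; intros x; unfold f, g; cbn; rewrite (@lie_fun0 R G X (D0 R)) by reflexivity.
  - rewrite gmulg1; f_equal; apply D_eq; cbn; ring.
  - rewrite gmul1g; f_equal; apply D_eq; cbn; ring. }
exact (f_equal (fun h => h (exist _ (d, e) H)) E).
Qed.

(** Both products are maps on [D(2)] restricting to [X] and [Y] on the axes. *)
Lemma lie_fun_comm X Y d e : (d : R) * e = 0 -> X d \* Y e = Y e \* X d.
Proof.
intros H.
pose (f (x : D2 R) := X (fst (proj1_sig x)) \* Y (snd (proj1_sig x))).
pose (g (x : D2 R) := Y (snd (proj1_sig x)) \* X (fst (proj1_sig x))).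
assert (E : f = g).
{ apply D2_map_eq; intros x; unfold f, g; cbn.
  - now rewrite (@lie_fun0 R G Y (D0 R)), gmulg1, gmul1g.
  - now rewrite (@lie_fun0 R G X (D0 R)), gmulg1, gmul1g. }
exact (f_equal (fun h => h (exist _ (d, e) H)) E).
Qed.

Lemma lie_addE X Y d : (X \+ Y) d = X d \* Y d.
Proof.
unfold lie_add; destruct (constructive_definite_description _ _) as (Z & l & Hl & Hr & HZ); cbn.
rewrite HZ.
pose (g (x : D2 R) := X (fst (proj1_sig x)) \* Y (snd (proj1_sig x))).
assert (E : l = g).
{ apply D2_map_eq; intros x; unfold g; cbn; rewrite ?Hl, ?Hr.
  - now rewrite (@lie_fun0 R G Y (D0 R)), gmulg1.
  - now rewrite (@lie_fun0 R G X (D0 R)), gmul1g. }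
now rewrite E.
Qed.

Definition lie_zero : lie_algebra G := exist _ (fun _ => gone) eq_refl.

Lemma lie_addA X Y Z : X \+ (Y \+ Z) = X \+ Y \+ Z.
Proof. apply lie_ext; intros d; rewrite !lie_addE; apply gmulA. Qed.

Lemma lie_addC X Y : X \+ Y = Y \+ X.
Proof.
apply lie_ext; intros d; rewrite !lie_addE; apply lie_fun_comm; exact (proj2_sig d).
Qed.

Lemma lie_add0 X : lie_zero \+ X = X.
Proof. apply lie_ext; intros d; rewrite lie_addE; apply gmul1g. Qed.

Lemma lie_addN X : X \+ lie_opp X = lie_zero.
Proof.
apply lie_ext; intros d; rewrite lie_addE, <- (lie_fun_opp X d) at 1.
cbn; f_equal; unfold lie_fun; cbn; f_equal; apply D_eq; cbn; ring.
Qed.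

Lemma lie_scaleDr (a : R) X Y : a \*: (X \+ Y) = a \*: X \+ a \*: Y.
Proof. apply lie_ext; intros d; rewrite lie_addE; cbn; apply lie_addE. Qed.

Lemma lie_scaleDl (a b : R) X : (a + b) \*: X = a \*: X \+ b \*: X.
Proof.
apply lie_ext; intros d; rewrite lie_addE; cbn.
assert (H : (Dscale a d : R) * Dscale b d = 0).
{ destruct d as [d Hd]; cbn; transitivity (a * b * (d * d)); [ring | rewrite Hd; ring]. }
fold (lie_fun X); rewrite <- (lie_funD X H); f_equal; apply D_eq; cbn; ring.
Qed.

Lemma lie_scaleA (a b : R) X : (a * b) \*: X = a \*: (b \*: X).
Proof. apply lie_ext; intros d; cbn; f_equal; apply D_eq; cbn; ring. Qed.

Lemma lie_scale1 X : 1 \*: X = X.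
Proof. apply lie_ext; intros d; cbn; unfold lie_fun; f_equal; apply D_eq; cbn; ring. Qed.

Lemma lie_scale0 X : 0 \*: X = lie_zero.
Proof. apply lie_ext; intros d; cbn; apply (@lie_fun0 R G); cbn; ring. Qed.

Lemma lie_scalez (a : R) : a \*: lie_zero = lie_zero.
Proof. now apply lie_ext. Qed.

(** * Deciding module identities *)

(** Nagata's idealization: [R + g] with [g] an ideal of square zero.  A linear
    identity in [g] is an identity in this commutative ring, where [ring] decides
    it. *)
Lemma idealization_th : ring_theory (R := R * lie_algebra G) (0, lie_zero) (1, lie_zero)
  (fun u v => (fst u + fst v, snd u \+ snd v))
  (fun u v => (fst u * fst v, fst u \*: snd v \+ fst v \*: snd u))
  (fun u v => (fst u + - fst v, snd u \- snd v))
  (fun u => (- fst u, lie_opp (snd u))) eq.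
Proof.
split; repeat intros [? ?]; cbn; apply f_equal2; try ring.
- apply lie_add0.
- apply lie_addC.
- apply lie_addA.
- now rewrite lie_scale1, lie_scalez, lie_addC, lie_add0.
- apply lie_addC.
- rewrite !lie_scaleDr, <- !lie_scaleA, lie_addA.
  f_equal; [f_equal |]; f_equal; ring.
- rewrite !lie_scaleDr, lie_scaleDl, !lie_addA; f_equal.
  rewrite <- !lie_addA; f_equal; apply lie_addC.
- reflexivity.
- apply lie_addN.
Qed.

Definition idealization : comm_ring := CommRing idealization_th.
Definition idl_scalar (a : R) : idealization := (a, lie_zero).
Definition idl_vector X : idealization := (0, X).

Lemma idl_scalarD a b : idl_scalar (a + b) = idl_scalar a + idl_scalar b.
Proof. unfold idl_scalar; cbn; now rewrite lie_add0. Qed.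
Lemma idl_scalarM a b : idl_scalar (a * b) = idl_scalar a * idl_scalar b.
Proof. unfold idl_scalar; cbn; now rewrite !lie_scalez, lie_add0. Qed.
Lemma idl_scalarN a : idl_scalar (- a) = - idl_scalar a.
Proof. unfold idl_scalar, lie_opp; cbn; unfold lie_opp; now rewrite lie_scalez. Qed.
Lemma idl_scalar_sqr d : idl_scalar (Dval d) * idl_scalar (Dval d) = 0.
Proof. rewrite <- idl_scalarM; destruct d as [d Hd]; cbn; now rewrite Hd. Qed.

Lemma idl_scalar_cube (t : R) :
  t * t * t = 0 -> idl_scalar t * idl_scalar t * idl_scalar t = 0.
Proof. intros H; now rewrite <- !idl_scalarM, H. Qed.

Lemma idl_vectorD X Y : idl_vector (X \+ Y) = idl_vector X + idl_vector Y.
Proof. unfold idl_vector; cbn; f_equal; ring. Qed.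
Lemma idl_vectorZ a X : idl_vector (a \*: X) = idl_scalar a * idl_vector X.
Proof.
unfold idl_vector, idl_scalar; cbn; rewrite lie_scalez, lie_addC, lie_add0; f_equal; ring.
Qed.
Lemma idl_vectorN X : idl_vector (lie_opp X) = - idl_vector X.
Proof. unfold idl_vector; cbn; f_equal; ring. Qed.
Lemma idl_vector_inj X Y : idl_vector X = idl_vector Y -> X = Y.
Proof. now intros [=]. Qed.

(** Lets [ring] compute with the rational coefficients of the formula. *)
Definition idl_Q (q : Q) : idealization := idl_scalar (of_Q q).

Lemma idl_Q_morph : ring_morph (R := idealization) 0 1 (@radd _) (@rmul _) (@rsub _) (@ropp _)
                 eq 0%Q 1%Q Qplus Qmult Qminus Qopp Qeq_bool idl_Q.
Proof.
pose proof (of_Q_morph R) as M; unfold idl_Q; split.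
- now rewrite (morph0 M).
- now rewrite (morph1 M).
- intros x y; rewrite (morph_add M); apply idl_scalarD.
- intros x y; rewrite (morph_sub M), (Rsub_def (rth R)), (Rsub_def (rth idealization)).
  now rewrite idl_scalarD, idl_scalarN.
- intros x y; rewrite (morph_mul M); apply idl_scalarM.
- intros x; rewrite (morph_opp M); apply idl_scalarN.
- intros x y H; now rewrite (morph_eq M x y H).
Qed.

(** Only literals may be constants: [0] and [1] are not convertible to the images
   of the rationals 0 and 1, and [ring] recognises them by itself. *)
Ltac idl_Q_constant t :=
  match t with
  | idl_Q ?q => q
  | _ => constr:(InitialRing.NotConstant)
  end.
Add Ring idealization_ring : (rth idealization)
  (morphism idl_Q_morph, constants [idl_Q_constant]).

(** Turns an equality of linear combinations of tangent vectors into one of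
    polynomials over the idealization, the brackets becoming indeterminates. *)
Ltac to_idealization :=
  apply idl_vector_inj;
  repeat first [rewrite idl_vectorD | rewrite idl_vectorN | rewrite idl_vectorZ];
  change (idl_vector lie_zero) with (0 : idealization);
  repeat first [rewrite idl_scalarD | rewrite idl_scalarM | rewrite idl_scalarN];
  change (idl_scalar 0) with (0 : idealization);
  change (idl_scalar 1) with (1 : idealization);
  repeat match goal with |- context [idl_scalar (of_Q ?q)] =>
    change (idl_scalar (of_Q q)) with (idl_Q q) end.

(** * The bracket *)

Lemma lie_bracketE X Y : is_lie_bracket X Y [[X, Y]].
Proof. unfold lie_bracket; now destruct (constructive_definite_description _ _). Qed.

Lemma lie_bracket_unique X Y Z : is_lie_bracket X Y Z -> Z = [[X, Y]].
Proof.
intros H; destruct (lie_bracket_exists X Y) as (B & _ & UB).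
now rewrite <- (UB _ H); apply UB, lie_bracketE.
Qed.

Lemma lie_fun_oppl X d : X (Dopp d) \* X d = gone.
Proof.
rewrite <- (lie_fun_opp X (Dopp d)); f_equal; unfold lie_fun; f_equal; apply D_eq; cbn; ring.
Qed.

Lemma gmulgI (x y z : G) : x \* y = x \* z -> y = z.
Proof.
intros H; rewrite <- (gmul1g y), <- (gmul1g z), <- (gmulVg x), <- !gmulA; now f_equal.
Qed.

Lemma lie_oppE X d : lie_opp X d = X (Dopp d).
Proof. cbn; fold (lie_fun X); f_equal; apply D_eq; cbn; ring. Qed.

Lemma Dscale_mulr d e : (Dscale d e : R) * e = 0.
Proof. destruct e as [e He]; cbn; rewrite <- (Rmul_assoc (rth R)), He; ring. Qed.

Lemma Dscale_mull d e : (Dscale d e : R) * d = 0.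
Proof. destruct d as [d Hd]; cbn; transitivity (d * d * e); [ring | rewrite Hd; ring]. Qed.

(** [[X, Y]] at [de] commutes with [X(d)] and [Y(e)], because [de] is killed by
    both [d] and [e]; so the commutator may be written on any side. *)
Lemma lie_bracket_swap X Y d e :
  X d \* Y e = Y e \* X d \* [[X, Y]] (Dscale d e).
Proof.
assert (E : X d \* Y e = [[X, Y]] (Dscale d e) \* Y e \* X d).
{ rewrite (lie_bracketE X Y d e), <- !gmulA, (gmulA (Y (Dopp e))), lie_fun_oppl.
  now rewrite gmul1g, lie_fun_oppl, gmulg1. }
rewrite E, (lie_fun_comm [[X, Y]] Y (Dscale_mulr d e)), <- !gmulA; f_equal.
apply lie_fun_comm, Dscale_mull.
Qed.

Lemma lie_scaleE a X d : (a \*: X) d = X (Dscale a d).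
Proof. reflexivity. Qed.

(** The group commutators of two elements in either order are inverse to each
    other. *)
Lemma lie_bracketN X Y : [[Y, X]] = lie_opp [[X, Y]].
Proof.
symmetry; apply lie_bracket_unique; intros d e.
apply (gmulgI (x := [[X, Y]] (Dscale e d))).
rewrite lie_oppE.
replace (Dopp (Dscale d e)) with (Dopp (Dscale e d)) by (apply D_eq; cbn; ring).
replace (Dscale d e) with (Dscale e d) by (apply D_eq; cbn; ring).
rewrite lie_fun_opp, (lie_bracketE X Y e d), <- !gmulA.
rewrite (gmulA (Y (Dopp d))), lie_fun_oppl, gmul1g, (gmulA (X (Dopp e))), lie_fun_oppl, gmul1g.
now rewrite (gmulA (Y d)), !lie_fun_opp, gmul1g, lie_fun_opp.
Qed.

Lemma lie_bracketZl (a : R) X Y : [[a \*: X, Y]] = a \*: [[X, Y]].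
Proof.
symmetry; apply lie_bracket_unique; intros d e; rewrite !lie_scaleE.
replace (Dscale a (Dopp d)) with (Dopp (Dscale a d)) by (apply D_eq; cbn; ring).
rewrite <- lie_bracketE; f_equal; apply D_eq; cbn; ring.
Qed.

Lemma lie_bracketZr (a : R) X Y : [[X, a \*: Y]] = a \*: [[X, Y]].
Proof. rewrite lie_bracketN, lie_bracketZl, (lie_bracketN Y X); to_idealization; ring. Qed.

Lemma is_lie_bracketP X Y Z :
  (forall d e, X d \* Y e = Y e \* X d \* Z (Dscale d e)) -> Z = [[X, Y]].
Proof.
intros H; apply lie_bracket_unique; intros d e; rewrite <- lie_bracketE.
apply (gmulgI (x := Y e \* X d)); now rewrite <- H, lie_bracket_swap.
Qed.

Lemma lie_bracketDl X Y Z : [[X \+ Y, Z]] = [[X, Z]] \+ [[Y, Z]].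
Proof.
symmetry; apply is_lie_bracketP; intros d e; rewrite !lie_addE.
rewrite <- gmulA, (lie_bracket_swap Y), !gmulA, (lie_bracket_swap X), <- !gmulA; do 2 f_equal.
rewrite !gmulA; f_equal; apply lie_fun_comm, Dscale_mull.
Qed.

Lemma lie_bracketDr X Y Z : [[X, Y \+ Z]] = [[X, Y]] \+ [[X, Z]].
Proof.
rewrite lie_bracketN, lie_bracketDl, (lie_bracketN X), (lie_bracketN X Z); to_idealization; ring.
Qed.

(** Antisymmetry gives [2[X, X] = 0], and 2 is invertible in a Q-algebra. *)
Lemma lie_bracketXX X : [[X, X]] = lie_zero.
Proof.
transitivity (of_Q (1 # 2) \*: ([[X, X]] \- lie_opp [[X, X]])); [to_idealization; ring |].
rewrite <- lie_bracketN; to_idealization; ring.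
Qed.

Lemma lie_bracketz X : [[X, lie_zero]] = lie_zero.
Proof. rewrite <- (lie_scale0 X), lie_bracketZr; to_idealization; ring. Qed.

Lemma lie_bracketNr X Y : [[X, lie_opp Y]] = lie_opp [[X, Y]].
Proof. apply lie_bracketZr. Qed.

Lemma lie_bracketNl X Y : [[lie_opp X, Y]] = lie_opp [[X, Y]].
Proof. apply lie_bracketZl. Qed.

Lemma lie_zbracket X : [[lie_zero, X]] = lie_zero.
Proof. rewrite lie_bracketN, lie_bracketz; to_idealization; ring. Qed.

Ltac bracket_expand :=
  repeat first [rewrite lie_bracketDr | rewrite lie_bracketDl
    | rewrite lie_bracketNr | rewrite lie_bracketNl
    | rewrite lie_bracketZr | rewrite lie_bracketZl
    | rewrite lie_bracketz | rewrite lie_zbracket].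

(** * The derivative of the exponential map *)

Variable HG : regular G.

Lemma integralP (sigma : R -> lie_algebra G) : is_integral sigma (integral HG sigma).
Proof. unfold integral; now destruct (constructive_definite_description _ _). Qed.

Lemma integral_unique (sigma : R -> lie_algebra G) (gamma : R -> G) :
  is_integral sigma gamma -> gamma = integral HG sigma.
Proof.
intros H; destruct (HG sigma) as (g & _ & Ug).
rewrite <- (Ug _ H); apply Ug, integralP.
Qed.

(** The hypothesis is the differential equation [W' = V - [X, W]].  It makes
    [u |-> W(0)(-d) exp(uX) W(u)(d)] an integral of the constant [X + dV], as the
    term [[X, W](ed)] produced by moving [X(e)] past [W(u)(d)] is compensated by
    [W'].  Conjugation ([V = 0]) and the derivative of [exp] ([W(0) = 0]) are the
    two main instances. *)
Lemma lie_exp_twist X (V : lie_algebra G) (W : R -> lie_algebra G) d :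
  (forall (t : R) e, W (t + e) = W t \+ (e : R) \*: (V \- [[X, W t]])) ->
  W 0 d \* lie_exp HG (X \+ (d : R) \*: V) = lie_exp HG X \* W 1 d.
Proof.
intros HW.
destruct (integralP (fun _ => X)) as [x0 xD].
set (x := integral HG (fun _ => X)) in *.
pose (gamma t := W 0 (Dopp d) \* x t \* W t d).
assert (E : gamma = integral HG (fun _ => X \+ (d : R) \*: V)).
{ apply integral_unique; split.
  - unfold gamma; now rewrite x0, gmulg1, lie_fun_oppl.
  - intros t e; unfold gamma; rewrite xD, HW, !lie_addE, !lie_scaleE, <- !gmulA.
    do 2 f_equal.
    rewrite (gmulA (X e)), lie_bracket_swap, <- !gmulA; do 2 f_equal.
    replace (Dscale d e) with (Dscale e d) by (apply D_eq; cbn; ring).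
    rewrite <- lie_addE; f_equal; f_equal; to_idealization; ring. }
apply (f_equal (fun f => f 1)) in E; unfold gamma in E.
unfold lie_exp; rewrite <- E; fold x.
now rewrite !gmulA, lie_fun_opp, gmul1g.
Qed.

(** The solution of the equation with [W(0) = W] is the series
    [e^(-u ad X) W + (1 - e^(-u ad X))/(ad X) V], which the hypotheses truncate. *)
Lemma lie_exp_conj_deriv X (V W : lie_algebra G) d :
  [[X, [[X, V]]]] = lie_zero -> [[X, [[X, [[X, W]]]]]] = lie_zero ->
  W d \* lie_exp HG (X \+ (d : R) \*: V) = lie_exp HG X \*
   (W \- [[X, W]] \+ of_Q (1 # 2) \*: [[X, [[X, W]]]] \+ V \- of_Q (1 # 2) \*: [[X, V]]) d.
Proof.
intros HV HW.
pose (P (t : R) := W \- t \*: [[X, W]] \+ (of_Q (1 # 2) * (t * t)) \*: [[X, [[X, W]]]]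
  \+ t \*: V \- (of_Q (1 # 2) * (t * t)) \*: [[X, V]]).
transitivity (P 0 d \* lie_exp HG (X \+ (d : R) \*: V)).
{ do 2 f_equal; unfold P; to_idealization; ring. }
rewrite (lie_exp_twist (X := X) (V := V)).
- do 2 f_equal; unfold P; to_idealization; ring.
- intros t e; unfold P.
  bracket_expand; rewrite HV, HW.
  to_idealization; ring [(idl_scalar_sqr e)].
Qed.

Lemma lie_exp_deriv X (V : lie_algebra G) d :
  [[X, [[X, V]]]] = lie_zero ->
  lie_exp HG (X \+ (d : R) \*: V) = lie_exp HG X \* (V \- of_Q (1 # 2) \*: [[X, V]]) d.
Proof.
intros HV; rewrite <- (gmul1g (lie_exp HG (X \+ _))).
change gone with (lie_zero d) at 1; rewrite lie_exp_conj_deriv by now rewrite ?lie_bracketz.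
do 2 f_equal; rewrite !lie_bracketz; to_idealization; ring.
Qed.

(** * Polynomial curves of order three *)

Definition jet (t : R) (a b c : lie_algebra G) : lie_algebra G :=
  a \+ t \*: b \+ (t * t) \*: c.

Lemma jet_bracket (t : R) (a b c a' b' c' : lie_algebra G) : t * t * t = 0 ->
  [[jet t a b c, jet t a' b' c']]
  = jet t [[a, a']] ([[a, b']] \+ [[b, a']]) ([[a, c']] \+ [[b, b']] \+ [[c, a']]).
Proof.
intros Ht; unfold jet.
rewrite !lie_bracketDl, !lie_bracketDr, !lie_bracketZl, !lie_bracketZr.
to_idealization; ring [(idl_scalar_cube Ht)].
Qed.

Definition cubic (t : R) X Y Z : lie_algebra G :=
  t \*: X \+ (of_Q (1 # 2) * (t * t)) \*: Y \+ (of_Q (1 # 6) * (t * t * t)) \*: Z.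

(** Taylor expansion; both the curve and its velocity are truncated by
    [t^3 = 0]. *)
Lemma cubic_succ (t : R) d X Y Z : t * t * t = 0 ->
  cubic (t + d) X Y Z = jet t lie_zero X (of_Q (1 # 2) \*: Y)
    \+ (d : R) \*: jet t X Y (of_Q (1 # 2) \*: Z).
Proof.
intros Ht.
unfold cubic, jet; to_idealization; ring [(idl_scalar_cube Ht) (idl_scalar_sqr d)].
Qed.

Lemma cubic_jet (t : R) X Y Z : t * t * t = 0 ->
  cubic t X Y Z = jet t lie_zero X (of_Q (1 # 2) \*: Y).
Proof.
intros Ht; unfold cubic; rewrite Ht; unfold jet; to_idealization; ring.
Qed.

(** The linear term of the bracket of a cubic curve with its velocity is
    [[X, X] = 0], whence order 2.  This is what makes all further brackets with
    the curve vanish. *)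
Lemma jet_bracket_velocity (t : R) X Y Z : t * t * t = 0 ->
  [[jet t lie_zero X (of_Q (1 # 2) \*: Y), jet t X Y (of_Q (1 # 2) \*: Z)]]
  = jet t lie_zero lie_zero (of_Q (1 # 2) \*: [[X, Y]]).
Proof.
intros Ht; rewrite (jet_bracket _ _ _ _ _ _ Ht).
rewrite !lie_zbracket, lie_bracketXX, lie_bracketZl, (lie_bracketN X Y).
unfold jet; to_idealization; ring.
Qed.

(** * The Baker-Campbell-Hausdorff formula *)

Section BCH.
Variables X1 X2 X3 Y1 Y2 Y3 : lie_algebra G.
Let Z1 := X1 \+ Y1.
Let Z2 := X2 \+ Y2 \+ [[X1, Y1]].
Let Z3 := (X3 \+ Y3) \+ of_Q (3 # 2) \*: ([[X1, Y2]] \+ [[X2, Y1]])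
  \+ of_Q (1 # 2) \*: [[X1 \- Y1, [[X1, Y1]]]].

Definition bch_at (t : R) : Prop :=
  lie_exp HG (cubic t X1 X2 X3) \* lie_exp HG (cubic t Y1 Y2 Y3)
  = lie_exp HG (cubic t Z1 Z2 Z3).

(** With [V], [U], [T] the velocities of the three curves [X], [Y], [Z] at [t],
    the left side at [t + d] is [exp X W(d) exp(Y + dU)] for [W = V - [X, V]/2];
    moving [W(d)] to the right turns both sides into [exp Z] times a tangent
    vector at [d]. *)
Lemma bch_step (t : R) d : t * t * t = 0 -> bch_at t -> bch_at (t + d).
Proof.
unfold bch_at; intros Ht; rewrite !(cubic_jet _ _ _ Ht), !(cubic_succ d _ _ _ Ht); intros IH.
assert (HV : forall A B C, [[jet t lie_zero A (of_Q (1 # 2) \*: B),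
  [[jet t lie_zero A (of_Q (1 # 2) \*: B), jet t A B (of_Q (1 # 2) \*: C)]]]] = lie_zero).
{ intros A B C; rewrite (jet_bracket_velocity _ _ _ Ht), (jet_bracket _ _ _ _ _ _ Ht).
  rewrite !lie_zbracket, !lie_bracketz; unfold jet; to_idealization; ring. }
rewrite (lie_exp_deriv d (HV X1 X2 X3)), (lie_exp_deriv d (HV Z1 Z2 Z3)).
rewrite <- gmulA, lie_exp_conj_deriv, gmulA, IH.
- f_equal; f_equal.
  rewrite !(jet_bracket_velocity _ _ _ Ht).
  rewrite !lie_bracketDr, !lie_bracketNr, !lie_bracketZr.
  rewrite !(jet_bracket _ _ _ _ _ _ Ht), !lie_zbracket, !lie_bracketz.
  unfold jet, Z3, Z2, Z1.
  bracket_expand.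
  (* orients the brackets, so that [ring] sees [X1, Y1] and [Y1, X1] as one
     indeterminate up to sign *)
  rewrite !(lie_bracketN X1), !(lie_bracketN X2 Y1).
  bracket_expand.
  to_idealization; ring.
- apply HV.
- rewrite !(jet_bracket_velocity _ _ _ Ht).
  rewrite !lie_bracketDr, !lie_bracketNr, !lie_bracketZr.
  rewrite !(jet_bracket _ _ _ _ _ _ Ht); unfold jet; bracket_expand.
  to_idealization; ring.
Qed.

Lemma bch_at_0 : bch_at 0.
Proof.
unfold bch_at.
assert (E : forall X Y Z, cubic 0 X Y Z = lie_zero)
  by (intros; unfold cubic; to_idealization; ring).
rewrite !E.
assert (e0 : lie_exp HG lie_zero = gone).
{ unfold lie_exp; rewrite <- (@integral_unique (fun _ => lie_zero) (fun _ => gone)); [easy |].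
  split; [easy |]; intros t e; symmetry; apply gmulg1. }
now rewrite e0, gmulg1.
Qed.

Lemma bch_at_sum3 d1 d2 d3 : bch_at (d1 + d2 + d3).
Proof.
assert (K1 : (Dval d1 : R) * d1 = 0) by exact (proj2_sig d1).
assert (K2 : (Dval d2 : R) * d2 = 0) by exact (proj2_sig d2).
apply bch_step; [ring [K1 K2] |].
apply bch_step; [ring [K1] |].
replace (Dval d1) with (0 + Dval d1 : R) by ring.
apply bch_step; [ring | apply bch_at_0].
Qed.
End BCH.
End LieGroup.

Theorem theorem18 (R : line) (G : lie_group R) (HG : regular G)
    (d1 d2 d3 : D R) (X1 X2 X3 Y1 Y2 Y3 : lie_algebra G) :
  let exp := lie_exp HG in
  let s : R := d1 + d2 + d3 in
  let half : R := of_Q (1 # 2) in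
  let sixth : R := of_Q (1 # 6) in
  let three_halves : R := of_Q (3 # 2) in
  exp (s \*: X1 \+ (half * (s * s)) \*: X2 \+ (sixth * (s * s * s)) \*: X3) \*
  exp (s \*: Y1 \+ (half * (s * s)) \*: Y2 \+ (sixth * (s * s * s)) \*: Y3)
  = exp (s \*: (X1 \+ Y1)
         \+ (half * (s * s)) \*: (X2 \+ Y2 \+ [[X1, Y1]])
         \+ (sixth * (s * s * s)) \*:
              ((X3 \+ Y3)
               \+ three_halves \*: ([[X1, Y2]] \+ [[X2, Y1]])
               \+ half \*: [[X1 \- Y1, [[X1, Y1]]]])).
Proof.
exact (bch_at_sum3 HG X1 X2 X3 Y1 Y2 Y3 d1 d2 d3).
Qed.
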